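(* Let $q$ be a prime power, $Y \subseteq \mathbb{F}_q$ and $E \subseteq \mathbb{F}_q^2$. Then there exists $y\in Y$ such that \[ |\{ay+b : (a,b)\in E\}| \gg \min\left\{ |Y|^{1/2}q^{1/2},\ \frac{|Y|^{1/2}|E|}{q},\ |E| \right\}. \]
   Context: $\mathbb{F}_q$ is the finite field with $q$ elements. The notation $f\gg g$ means $f\ge cg$ for an absolute constant $c>0$ not depending on any other parameters. *)

(* Defs.v *)
From HB Require Import structures.
From mathcomp Require Import all_boot all_order all_algebra.
From mathcomp Require Import reals.

Set Implicit Arguments.
Unset Strict Implicit.
Unset Printing Implicit Defensive.

(* Main.v *)
(** Let [N_y] be the number of values of [a y + b] on [E] and [C_y] the number
    of pairs of points of [E] at which [a y + b] takes the same value.  Two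
    distinct points collide for at most one [y], so the sum of [C_y] over the
    whole field is at most [q |E| + |E|^2].  By Cauchy-Schwarz
    [C_y >= |E|^2 / N_y], which is at least [|E|^2 / q] for every [y]; using
    this trivial bound off [Y], some [y] in [Y] must satisfy
    [1 / N_y <= 1 / q + q / (|Y| |E|)], hence
    [N_y >= min (q, |Y| |E| / q) / 2].  This is stronger than the claim because
    [1 <= |Y| <= q]. *)
Require Import Defs.
From HB Require Import structures.
From mathcomp Require Import all_boot all_order all_algebra.
From mathcomp Require Import reals.
From mathcomp Require Import ring lra.

Set Implicit Arguments.
Unset Strict Implicit.
Unset Printing Implicit Defensive.

Import Order.TTheory GRing.Theory Num.Theory.

Local Open Scope ring_scope.

Definition collisions (T : finType) (U : eqType) (f : T -> U) (A : {set T}) :=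
  (\sum_(p in A) \sum_(p' in A) (f p == f p'))%N.

(** Sum [2 x_i x_j <= x_i ^ 2 + x_j ^ 2] over all pairs; the factor 2 is inserted first so that
    everything stays in [nat]. *)
Lemma sqr_sum_leq (T : finType) (A : {set T}) (x : T -> nat) :
  ((\sum_(i in A) x i) ^ 2 <= #|A| * \sum_(i in A) x i ^ 2)%N.
Proof.
rewrite -(@leq_pmul2l 2) // -mulnn big_distrlr /= big_distrr /=.
have -> : (2 * (#|A| * \sum_(i in A) x i ^ 2) =
    \sum_(i in A) \sum_(j in A) (x i ^ 2 + x j ^ 2))%N.
  under [RHS]eq_bigr => i _ do rewrite big_split /= sum_nat_const.
  by rewrite big_split /= -big_distrr /= sum_nat_const addnn mul2n.
apply: leq_sum => i _; rewrite big_distrr /=; apply: leq_sum => j _.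
exact: nat_Cauchy.
Qed.

(** [collisions f A] is the sum of the squared fibre sizes, so this is Cauchy-Schwarz over the
    image. *)
Lemma sqr_card_leq_collisions (T U : finType) (f : T -> U) (A : {set T}) :
  (#|A| ^ 2 <= #|f @: A| * collisions f A)%N.
Proof.
have sumE (G : T -> nat) := partition_big_imset f A G.
have -> : collisions f A =
    (\sum_(u in f @: A) (\sum_(p in A | f p == u) 1) ^ 2)%N.
  rewrite /collisions sumE; apply: eq_bigr => u _.
  rewrite -mulnn big_distrl /=; apply: eq_bigr => p /andP[_ /eqP <-].
  rewrite mul1n [RHS]big_mkcondr /=; apply: eq_bigr => p' _.
  by rewrite eq_sym; case: eqP.
by rewrite -sum1_card sumE sqr_sum_leq.
Qed.

(** Subtracting the coincidences at [y] and [z] leaves [(p.1 - p'.1) * (y - z) = 0]; equal slopes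
    would force equal intercepts. *)
Lemma card_line_meet_leq1 (F : finFieldType) (p p' : F * F) : p != p' ->
  (\sum_(y : F) (p.1 * y + p.2 == p'.1 * y + p'.2)%R <= 1)%N.
Proof.
move=> pp'; rewrite -big_mkcond sum1_card.
apply/card_le1_eqP => y z; rewrite !unfold_in => /eqP hy /eqP hz.
have : (p.1 - p'.1) * (y - z) = 0.
  transitivity ((p.1 * y + p.2) - (p'.1 * y + p'.2) -
                ((p.1 * z + p.2) - (p'.1 * z + p'.2))); first by ring.
  by rewrite hy hz !subrr.
move/eqP; rewrite mulf_eq0 !subr_eq0 => /orP[/eqP p1|/eqP //].
case/eqP: pp'; case: p p' p1 hy {hz} => [a b] [a' b'] /= -> /addrI -> //.
Qed.

Lemma sum_collisions_leq (F : finFieldType) (E : {set F * F}) :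
  (\sum_(y : F) collisions (fun p => p.1 * y + p.2)%R E
     <= #|F| * #|E| + #|E| ^ 2)%N.
Proof.
rewrite /collisions exchange_big /= -mulnn -mulnDl mulnC -sum_nat_const.
(* For fixed [p], the partner [p] itself collides at every [y], any other at most once. *)
apply: leq_sum => p pE; rewrite exchange_big /= (bigD1 p) //=.
apply: leq_add.
  by under eq_bigr do rewrite eqxx; rewrite sum1_card.
rewrite -sum1_card [leqRHS](bigD1 p) //= -[leqLHS]add0n leq_add //.
by apply: leq_sum => p' /andP[_ p'p]; apply: card_line_meet_leq1; rewrite eq_sym.
Qed.

Lemma exists_large_image (R : realFieldType) (F : finFieldType)
    (Y : {set F}) (E : {set F * F}) (m : R) :
  Y != set0 -> m <= #|F|%:R -> m <= #|Y|%:R * #|E|%:R / #|F|%:R ->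
  exists2 y, y \in Y &
    m / 2 <= #|[set ab.1 * y + ab.2 | ab in E]|%:R.
Proof.
move=> Y0 mq mYE; set q : R := #|F|%:R.
pose N y : R := #|[set ab.1 * y + ab.2 | ab in E]|%:R.
pose C y : R := (collisions (fun p => p.1 * y + p.2) E)%:R.
set e : R := #|E|%:R.
(* From here on, argue by contradiction: [N y < m / 2] throughout [Y]. *)
case: (pickP [pred y in Y | m / 2 <= N y]) => [y /andP[] | noy]; first by exists y.
have /set0Pn[y0 y0Y] := Y0.
have small y : y \in Y -> N y < m / 2.
  by move=> yY; have := noy y; rewrite /= yY /= real_leNgt ?num_real// => /negbFE.
have m0 : 0 < m.
  have := small _ y0Y; have : 0 <= N y0 by rewrite ler0n.
  lra.
have q0 : 0 < q by apply: lt_le_trans mq.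
have Y_gt0 : 0 < #|Y|%:R :> R by rewrite ltr0n card_gt0.
have e0 : 0 < e.
  rewrite lt0r ler0n andbT; apply: contraTneq mYE => e0.
  by rewrite -/e e0 mulr0 mul0r -ltNge.
have CS y : e ^+ 2 <= N y * C y.
  by rewrite -natrX -natrM ler_nat sqr_card_leq_collisions.
have C0 y : 0 <= C y by rewrite ler0n.
have CF y : e ^+ 2 / q <= C y.
  rewrite ler_pdivrMr // mulrC; apply: le_trans (CS y) _.
  by rewrite ler_wpM2r // ler_nat max_card.
(* Smallness of [N y] gives [C y > 2 e^2 / m]; since [m <= q], one of the two halves pays for the
   trivial bound [e^2 / q]. *)
have CY y : y \in Y -> e ^+ 2 / q + e ^+ 2 / m < C y.
  move=> yY.
  have lt_mC : e ^+ 2 * 2 / m < C y.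
    rewrite ltr_pdivrMr // -ltr_pdivlMr // -mulrA; apply: le_lt_trans (CS y) _.
    have C_gt0 : 0 < C y by apply: lt_le_trans (CF y); rewrite divr_gt0 ?exprn_gt0.
    by rewrite mulrC ltr_pM2l // small.
  apply: le_lt_trans lt_mC.
  have -> : e ^+ 2 * 2 / m = e ^+ 2 / m + e ^+ 2 / m by ring.
  by rewrite lerD2r ler_pM2l ?exprn_gt0 // lef_pV2.
have sumC : \sum_y C y <= q * e + e ^+ 2.
  by rewrite -natr_sum -natrX -natrM -natrD ler_nat sum_collisions_leq.
(* The trivial bounds over the field add up to [e^2], the excess on [Y] to the other term; [y0]
   makes the inequality strict. *)
have : e ^+ 2 + #|Y|%:R * (e ^+ 2 / m) < \sum_y C y.
  have -> : e ^+ 2 + #|Y|%:R * (e ^+ 2 / m) =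
      \sum_y (e ^+ 2 / q + (if y \in Y then e ^+ 2 / m else 0)).
    rewrite big_split /= -big_mkcond /= !sumr_const -!(mulr_natl (_ / _)).
    by rewrite -/q [q * _]mulrCA divff ?mulr1 // gt_eqF.
  rewrite (bigD1 y0) // [ltRHS](bigD1 y0) //= ltr_leD //.
    by rewrite y0Y CY.
  apply: ler_sum => y _; case: ifP => [/CY/ltW //|_].
  by rewrite addr0 CF.
(* Cancelling [e^2] and then [e] leaves [|Y| e / q < m], against [mYE]. *)
move=> /lt_le_trans /(_ sumC); rewrite addrC ltrD2r.
have -> : #|Y|%:R * (e ^+ 2 / m) = #|Y|%:R * e / m * e by ring.
rewrite ltr_pM2r // ltr_pdivrMr // [q * m]mulrC -ltr_pdivrMr //.
by rewrite ltNge mYE.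
Qed.

Theorem theorem2p4 (R : realType) :
  exists c : R, 0 < c /\
    forall (q : nat) (F : finFieldType) (Y : {set F}) (E : {set F * F}),
      #|F| = q -> Y != set0 ->
      exists y : F, y \in Y /\
        c * Num.min (Num.sqrt (#|Y|%:R) * Num.sqrt (q%:R))
              (Num.min (Num.sqrt (#|Y|%:R) * #|E|%:R / q%:R)
                       (#|E|%:R))
        <= #|[set ab.1 * y + ab.2 | ab in E]|%:R.
Proof.
exists 2^-1; split=> [|q F Y E <- Y0]; first by rewrite invr_gt0.
set m := Num.min _ _.
have Y1 : 1 <= #|Y|%:R :> R by rewrite ler1n card_gt0.
have [||y yY le_m] := @exists_large_image R F Y E m Y0.
(* [sqrt |Y| * sqrt q <= q] because [|Y| <= q]. *)
- rewrite /m ge_min; apply/orP; left.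
  rewrite -[leRHS]sqr_sqrtr // expr2 ler_wpM2r ?sqrtr_ge0 //.
  by rewrite ler_wsqrtr // ler_nat max_card.
(* [sqrt |Y| <= |Y|] because [|Y| >= 1]. *)
- rewrite /m !ge_min; apply/orP; right; apply/orP; left.
  rewrite ler_wpM2r ?invr_ge0 // ler_wpM2r //.
  have s1 : 1 <= Num.sqrt #|Y|%:R :> R by rewrite -[leLHS]sqrtr1 ler_wsqrtr.
  by rewrite -[leRHS]sqr_sqrtr // expr2 ler_peMl ?sqrtr_ge0.
- by exists y; rewrite mulrC.
Qed.
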